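(* Let $p$ and $q$ be nonnegative integers. There is a bijection between the set $\mathcal{D}^w(p,q)$ of weighted $(p,q)$ Delannoy paths and the set of ssymmetric $(2p,2q)$ clans. In particular, $$c_{p,q}=\sum_{W\in\mathcal{D}^w(p,q)}1,$$ where $c_{p,q}$ is the number of ssymmetric $(2p,2q)$ clans.
   Context: For nonnegative integers $p,q$ put $n=p+q$. A $(2p,2q)$ preclan is a string $c_1c_2\cdots c_{2n}$ whose entries are the symbols $+$, $-$ or natural numbers, such that the number of $+$'s minus the number of $-$'s equals $2p-2q$, and every number that appears in the string appears exactly twice. Two $(2p,2q)$ preclans are equivalent if they have the same signs in the same positions and the positions of the matching (equal) numbers are the same in both. A $(2p,2q)$ clan is an equivalence class of $(2p,2q)$ preclans. It is symmetric if a representing preclan $c_1\cdots c_{2n}$ is equivalent to its reversal $c_{2n}\cdots c_1$. A ssymmetric $(2p,2q)$ clan is a symmetric $(2p,2q)$ clan such that $c_i\ne c_{2n+1-i}$ whenever $c_i$ is a number. The number of ssymmetric $(2p,2q)$ clans is denoted $c_{p,q}$ (for all nonnegative $p,q$), with $c_{p,q}=1$ whenever $p=0$ or $q=0$. A Delannoy path in $\mathcal{D}(p,q)$ is a lattice path in $\mathbb{N}^2$ from $(0,0)$ to $(p,q)$ using the steps $E=(1,0)$, $N=(0,1)$ and $D=(1,1)$ only, written as the word $L_1\cdots L_r$ of its successive steps (each recorded with its starting and ending point). A $k$-diagonal step is a diagonal step of the form $((a,b),(a+1,b+1))$ with $a,b\in\mathbb{N}$ and $k=a+b+1$. A labelled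 step is a pair consisting of a step (of type $N$, $E$ or $D$) and a positive integer $m$, where $m=1$ if the step is of type $N$ or $E$. A weighted $(p,q)$ Delannoy path is a word $W=K_1\cdots K_r$ of labelled steps $K_i=(L_i,m_i)$ such that $L_1\cdots L_r$ is a Delannoy path in $\mathcal{D}(p,q)$ and, whenever $L_i$ is a $k$-diagonal step, $2\le m_i\le 2k+1$. The set of all weighted $(p,q)$ Delannoy paths is denoted $\mathcal{D}^w(p,q)$. *)

(* Defs.v *)
From HB Require Import structures.
From mathcomp Require Import all_boot generic_quotient ssralg ssrint.
From mathcomp Require Import zify.

Set Implicit Arguments.
Unset Strict Implicit.
Unset Printing Implicit Defensive.

Local Open Scope quotient_scope.

Inductive symbol : Type := Plus | Minus | Number of nat.

Definition symbol_code (x : symbol) : bool + nat :=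
  match x with Plus => inl true | Minus => inl false | Number k => inr k end.

Definition symbol_decode (x : bool + nat) : symbol :=
  match x with inl true => Plus | inl false => Minus | inr k => Number k end.

Lemma symbol_codeK : cancel symbol_code symbol_decode.
Proof. by case. Qed.

HB.instance Definition _ := Countable.copy symbol (can_type symbol_codeK).

Definition is_num (x : symbol) : bool := if x is Number _ then true else false.

Definition is_preclan p q (c : (2 * (p + q)).-tuple symbol) : bool :=
  ((count_mem Plus c)%:Z - (count_mem Minus c)%:Z
     == (2 * p)%:Z - (2 * q)%:Z)%R
  && all (fun x => is_num x ==> (count_mem x c == 2)) c.

Record preclan p q := Preclan {
  preclan_word :> (2 * (p + q)).-tuple symbol;
  _ : is_preclan preclan_word }.

HB.instance Definition _ p q := [isSub for @preclan_word p q].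
HB.instance Definition _ p q := [Countable of preclan p q by <:].

Definition matching n (c : n.-tuple symbol) (i j : 'I_n) : bool :=
  is_num (tnth c i) && (tnth c i == tnth c j).

Definition clan_equiv n (c d : n.-tuple symbol) : bool :=
  [forall i, ((tnth c i == Plus) == (tnth d i == Plus))
             && ((tnth c i == Minus) == (tnth d i == Minus))]
  && [forall i, forall j, matching c i j == matching d i j].

Lemma clan_equivP n (c d : n.-tuple symbol) :
  reflect [/\ forall i, (tnth c i == Plus) = (tnth d i == Plus),
              forall i, (tnth c i == Minus) = (tnth d i == Minus)
            & forall i j, matching c i j = matching d i j]
          (clan_equiv c d).
Proof.
apply: (iffP andP) => [[/forallP H1 /forallP H2]|[H1 H2 H3]].
  split=> [i|i|i j]; [by case/andP: (H1 i) => /eqP|by case/andP: (H1 i) => _ /eqP|].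
  by have /forallP/(_ j)/eqP := H2 i.
split; apply/forallP => i; first by rewrite H1 H2 !eqxx.
by apply/forallP => j; rewrite H3.
Qed.

Lemma clan_equiv_refl n : reflexive (@clan_equiv n).
Proof. by move=> c; apply/clan_equivP. Qed.

Lemma clan_equiv_sym n : symmetric (@clan_equiv n).
Proof. by move=> c d; apply/clan_equivP/clan_equivP => -[H1 H2 H3]; split. Qed.

Lemma clan_equiv_trans n : transitive (@clan_equiv n).
Proof.
move=> d c e /clan_equivP[H1 H2 H3] /clan_equivP[K1 K2 K3].
by apply/clan_equivP; split=> *; rewrite ?H1 ?H2 ?H3.
Qed.

Definition preclan_equiv p q : rel (preclan p q) :=
  fun c d => clan_equiv c d.

Lemma preclan_equiv_is_equiv p q :
  equiv_class_of (@preclan_equiv p q).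
Proof.
split=> [c|c d|d c e]; rewrite /preclan_equiv; first exact: clan_equiv_refl.
  exact: clan_equiv_sym.
exact: clan_equiv_trans.
Qed.

Canonical preclan_equiv_rel p q :=
  EquivRelPack (preclan_equiv_is_equiv p q).

Definition clan p q := {eq_quot (@preclan_equiv p q)}.

HB.instance Definition _ p q := Choice.on (clan p q).
HB.instance Definition _ p q := EqQuotient.on (clan p q).

(** The classes are finitely many: every preclan is equivalent to the one in
    which each number is replaced by the position of its first occurrence. *)

Section ClanFinite.
Variables p q : nat.
Local Notation len := (2 * (p + q)).

Definition first_pos (c : len.-tuple symbol) (i : 'I_len) : 'I_len :=
  [arg min_(j < i | tnth c j == tnth c i) (j : nat)].

Lemma first_posP c i : tnth c (first_pos c i) = tnth c i.
Proof. by rewrite /first_pos; case: arg_minnP => // j /eqP. Qed.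

Lemma first_pos_eq c i j :
  (first_pos c i == first_pos c j) = (tnth c i == tnth c j).
Proof.
apply/eqP/eqP => [E|E]; first by rewrite -(first_posP c i) E first_posP.
rewrite /first_pos.
case: arg_minnP => // a /eqP ea mina; case: arg_minnP => // b /eqP eb minb.
apply/val_inj/eqP; rewrite eqn_leq mina ?minb //; apply/eqP; congruence.
Qed.

Definition clan_shape (c : len.-tuple symbol) : len.-tuple (bool + 'I_len) :=
  [tuple match tnth c i with
         | Plus => inl true | Minus => inl false | Number _ => inr (first_pos c i)
         end | i < len].

Definition shape_word (t : len.-tuple (bool + 'I_len)) : len.-tuple symbol :=
  [tuple match tnth t i with
         | inl true => Plus | inl false => Minus | inr k => Number k
         end | i < len].

Lemma shape_wordE c i : tnth (shape_word (clan_shape c)) i =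
  if is_num (tnth c i) then Number (first_pos c i) else tnth c i.
Proof. by rewrite !tnth_mktuple; case: (tnth c i). Qed.

Lemma shape_word_equiv c : clan_equiv (shape_word (clan_shape c)) c.
Proof.
apply/clan_equivP; split=> [i|i|i j].
- by rewrite shape_wordE; case: (tnth c i).
- by rewrite shape_wordE; case: (tnth c i).
rewrite /matching !shape_wordE.
case Ei: (tnth c i) => [||k] //=; case Ej: (tnth c j) => [||l] //=.
rewrite -Ei -Ej -first_pos_eq.
by apply/eqP/eqP => [[/val_inj]|->].
Qed.

Lemma count_tnth (a : pred symbol) (c : len.-tuple symbol) :
  count a c = #|[pred i | a (tnth c i)]|.
Proof.
rewrite -[X in count a X]map_tnth_enum count_map cardE -size_filter.
by rewrite enumT.
Qed.

Lemma clan_equiv_preclan (c d : len.-tuple symbol) :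
  clan_equiv c d -> is_preclan d -> is_preclan c.
Proof.
move=> /clan_equivP[H1 H2 H3] /andP[cnt num]; apply/andP; split.
  rewrite !count_tnth (eq_card (B := [pred i | tnth d i == Plus])).
    rewrite (eq_card (A := [pred i | pred1 Minus (tnth c i)])
                     (B := [pred i | tnth d i == Minus])).
      by rewrite !count_tnth in cnt.
    by move=> i; rewrite !inE H2.
  by move=> i; rewrite !inE H1.
apply/allP => _ /tnthP[i ->]; apply/implyP => ni.
have := allP num _ (mem_tnth i d).
have nd : is_num (tnth d i).
  by have := H3 i i; rewrite /matching ni !eqxx !andbT => <-.
rewrite nd /= => /eqP num2; apply/eqP; rewrite -[RHS]num2 !count_tnth.
apply/eq_card => j.
by have := H3 i j; rewrite /matching ni nd !inE /= ![tnth _ j == _]eq_sym.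
Qed.

Definition clan_code (x : clan p q) : len.-tuple (bool + 'I_len) :=
  clan_shape (repr x).

Definition clan_decode (t : len.-tuple (bool + 'I_len)) : option (clan p q) :=
  omap (\pi_(clan p q)) (insub (shape_word t)).

Lemma clan_codeK : pcancel clan_code clan_decode.
Proof.
move=> x; rewrite /clan_decode /clan_code.
have eqv := shape_word_equiv (repr x).
rewrite insubT; first exact: clan_equiv_preclan eqv (valP (repr x)).
move=> H; rewrite /= -[in RHS](reprK x); congr Some; exact/eqmodP.
Qed.

End ClanFinite.

HB.instance Definition _ p q := PCanIsCountable (@clan_codeK p q).
HB.instance Definition _ p q : isFinite (clan p q) :=
  PCanIsFinite (@clan_codeK p q).

Definition symmetric_preclan p q (c : preclan p q) : bool :=
  clan_equiv c [tuple of rev c].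

Definition ssymmetric_preclan p q (c : preclan p q) : bool :=
  symmetric_preclan c
  && [forall i, is_num (tnth c i) ==> (tnth c i != tnth c (rev_ord i))].

Definition ssymmetric p q (x : clan p q) : bool := ssymmetric_preclan (repr x).

Lemma tnth_rev_tuple n (c : n.-tuple symbol) i :
  tnth [tuple of rev c] i = tnth c (rev_ord i).
Proof.
rewrite !(tnth_nth Plus) /= nth_rev ?size_tuple //.
Qed.

Lemma ssymmetric_preclan_equiv p q (c d : preclan p q) :
  clan_equiv c d -> ssymmetric_preclan c = ssymmetric_preclan d.
Proof.
suff H (a b : preclan p q) :
    clan_equiv a b -> ssymmetric_preclan a -> ssymmetric_preclan b.
  by move=> cd; apply/idP/idP; apply: H; rewrite // clan_equiv_sym.
move=> ab /andP[sa /forallP na]; have /clan_equivP[H1 H2 H3] := ab.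
apply/andP; split.
  rewrite /symmetric_preclan; apply: (@clan_equiv_trans _ (val a)).
    by rewrite clan_equiv_sym.
  apply: clan_equiv_trans sa _; apply/clan_equivP.
  by split=> *; rewrite /matching !tnth_rev_tuple ?H1 ?H2 //; apply: H3.
apply/forallP => i; apply/implyP => ni; apply/negP => ei.
have := H3 i (rev_ord i); rewrite {2}/matching ni ei.
by case/andP => n /eqP e; have := na i; rewrite n e eqxx.
Qed.

Lemma ssymmetric_pi p q (c : preclan p q) :
  ssymmetric (\pi_(clan p q) c) = ssymmetric_preclan c.
Proof.
by apply: ssymmetric_preclan_equiv; have /eqmodP := reprK (\pi_(clan p q) c).
Qed.

Definition ssymmetric_clan p q := {x : clan p q | ssymmetric x}.

Definition num_ssymmetric_clans p q : nat := #|[pred x : clan p q | ssymmetric x]|.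

Definition point := (nat * nat)%type.

(** A step is recorded as its pair (starting point, ending point). *)
Definition step := (point * point)%type.

Definition is_E (s : step) : bool := s.2 == (s.1.1 + 1, s.1.2).
Definition is_N (s : step) : bool := s.2 == (s.1.1, s.1.2 + 1).
Definition is_D (s : step) : bool := s.2 == (s.1.1 + 1, s.1.2 + 1).

(** A diagonal step [s] is a [diag_index s]-diagonal step. *)
Definition diag_index (s : step) : nat := s.1.1 + s.1.2 + 1.

Fixpoint joins (x : point) (L : seq step) (y : point) : bool :=
  if L is s :: L' then (s.1 == x) && joins s.2 L' y else x == y.

Definition is_delannoy p q (L : seq step) : bool :=
  all (fun s => [|| is_N s, is_E s | is_D s]) L && joins (0, 0) L (p, q).

Definition is_labelled_step (K : step * nat) : bool :=
  [&& [|| is_N K.1, is_E K.1 | is_D K.1],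
      0 < K.2
    & (is_N K.1 || is_E K.1) ==> (K.2 == 1)].

Definition is_weighted_delannoy p q (W : seq (step * nat)) : bool :=
  [&& all is_labelled_step W,
      is_delannoy p q [seq K.1 | K <- W]
    & all (fun K => is_D K.1 ==> (2 <= K.2 <= 2 * diag_index K.1 + 1)) W].

Record weighted_delannoy p q := WeightedDelannoy {
  wd_word :> seq (step * nat);
  _ : is_weighted_delannoy p q wd_word }.

HB.instance Definition _ p q := [isSub for @wd_word p q].
HB.instance Definition _ p q := [Countable of weighted_delannoy p q by <:].

Section WeightedDelannoyFinite.
Variables p q : nat.

Lemma joins_bounds (L : seq step) x :
  all (fun s => [|| is_N s, is_E s | is_D s]) L -> joins x L (p, q) ->
  [/\ x.1 <= p, x.2 <= q, size L <= (p - x.1) + (q - x.2)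
    & all (fun s => [&& s.1.1 <= p, s.1.2 <= q, s.2.1 <= p & s.2.2 <= q]) L].
Proof.
elim: L x => [|s L IH] [a b] /=; first by move=> _ /eqP[-> ->]; split; lia.
move=> /andP[st aL] /andP[/eqP s1 jL].
have [{IH} p1 p2 sz aB] := IH _ aL jL.
move: s s1 st p1 p2 sz {jL} => [s1 [c d]] /= ->.
rewrite /is_N /is_E /is_D /= !xpair_eqE => st p1 p2 sz.
by split; rewrite ?aB ?andbT; lia.
Qed.

Definition point_code (x : point) : 'I_p.+1 * 'I_q.+1 := (inord x.1, inord x.2).

Definition step_code (K : step * nat) :=
  (point_code K.1.1, point_code K.1.2, inord K.2 : 'I_(2 * (p + q) + 1).+1).

Definition step_decode (K : ('I_p.+1 * 'I_q.+1) * ('I_p.+1 * 'I_q.+1)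
                            * 'I_(2 * (p + q) + 1).+1) : step * nat :=
  ((K.1.1.1 : nat, K.1.1.2 : nat, (K.1.2.1 : nat, K.1.2.2 : nat)), K.2 : nat).

Definition wd_code (W : weighted_delannoy p q) :=
  insub_bseq (p + q) [seq step_code K | K <- W].

Definition wd_decode (t : (p + q).-bseq _) : option (weighted_delannoy p q) :=
  insub [seq step_decode K | K <- t].

Lemma wd_codeK : pcancel wd_code wd_decode.
Proof.
case=> W WP; rewrite /wd_decode /wd_code.
have /and3P[labW /andP[stW jW] dW] := WP.
have [_ _ szW bW] := joins_bounds stW jW.
rewrite /= !subn0 size_map in szW.
have -> : [seq step_decode K | K <- insub_bseq (p + q) [seq step_code K | K <- W]]
          = W.
  rewrite /insub_bseq /insubd insubT /= ?size_map // => _.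
  rewrite -map_comp -[RHS]map_id; apply/eq_in_map => K KW /=.
  have := allP bW K.1 (map_f _ KW); have := allP labW K KW; have := allP dW K KW.
  case: {KW} K => [[[a b] [c d]] m].
  rewrite /is_labelled_step /is_N /is_E /is_D /diag_index /= !xpair_eqE.
  move=> h1 h2 h3.
  by rewrite /step_decode /= !inordK //; lia.
by rewrite insubT /=; congr Some; apply: val_inj.
Qed.

End WeightedDelannoyFinite.

HB.instance Definition _ p q : isFinite (weighted_delannoy p q) :=
  PCanIsFinite (@wd_codeK p q).

(* Main.v *)
Require Import Defs.
From mathcomp Require Import all_boot generic_quotient ssralg ssrint zify.

(** Both families are finite, so it suffices that they are equinumerous, and
    this holds because their cardinals obey the same recurrence

      [c(p+1,q+1) = c(p,q+1) + c(p+1,q) + 2(p+q+1) c(p,q)]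

    with [c(0,0) = 1], [c(p+1,0) = c(p,0)] and [c(0,q+1) = c(0,q)].

    On the path side one deletes the last step.  It is E, N or a
    (p+q+1)-diagonal step, and the latter carries one of the 2(p+q+1) labels
    2, ..., 2(p+q+1)+1 ([card_weighted_delannoySS]).

    On the clan side, a clan is the same thing as an involution of its 2n
    positions, where n = p+q, which exchanges the two positions of each number and fixes the
    signs, together with the set of the positions of the +'s.  It is
    ssymmetric when this diagram commutes with the reversal rho of the
    positions and no position is matched with its mirror image
    ([card_ssymmetric_clans]).  Choose a position x.  If it bears a sign, so
    does rho x, with the same sign, and deleting both lowers p by one for a +
    and q by one for a -.  If it is matched with y, then y avoids x and rho x,
    which leaves 2(n-1) choices; rho x is matched with rho y, and deleting the
    four positions lowers both p and q by one ([card_ssym_diagrams_rec]).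
    Since deletions leave gaps among the positions, the recurrence is proved
    for diagrams on any subset, stable under rho, of a finite type endowed
    with a fixed-point free involution rho ([card_ssym_diagrams]). *)

Set Implicit Arguments.
Unset Strict Implicit.
Unset Printing Implicit Defensive.

Local Open Scope quotient_scope.

(** * Counting weighted Delannoy paths by their last step *)

Definition is_weighted_step (K : step * nat) : bool :=
  is_labelled_step K
  && (is_D K.1 ==> (2 <= K.2 <= 2 * diag_index K.1 + 1)).

Lemma joins_rcons x L s y :
  joins x (rcons L s) y = joins x L s.1 && (s.2 == y).
Proof.
elim: L x => [|s' L IH] x /=; first by rewrite [s.1 == x]eq_sym.
by rewrite IH andbA.
Qed.

Lemma weighted_delannoy_rcons p q W K :
  is_weighted_delannoy p q (rcons W K) =
  [&& is_weighted_step K, K.1.2 == (p, q)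
    & is_weighted_delannoy K.1.1.1 K.1.1.2 W].
Proof.
rewrite /is_weighted_delannoy /is_delannoy map_rcons !all_rcons joins_rcons.
rewrite /is_weighted_step /is_labelled_step.
case: K => [[[a b] e] m] /=.
apply/idP/idP.
  by case/and3P=> /andP[-> ->] /andP[/andP[_ ->] /andP[-> ->]] /andP[-> ->].
case/and3P=> /andP[/and3P[st -> ->] ->] -> /and3P[-> /andP[-> ->] ->].
by rewrite st.
Qed.

(** The three alternatives exclude each other because the three kinds of steps
    have different end points; a diagonal step has no label 1. *)
Lemma is_weighted_stepE a b c d m :
  is_weighted_step ((a, b, (c, d)), m) =
  [|| [&& c == a.+1, d == b & m == 1], [&& c == a, d == b.+1 & m == 1]
    | [&& c == a.+1, d == b.+1 & 2 <= m <= 2 * (a + b + 1) + 1]].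
Proof.
rewrite /is_weighted_step /is_labelled_step /is_N /is_E /is_D /diag_index /=.
rewrite !xpair_eqE !addn1.
have ca : ~~ ((c == a) && (c == a.+1)) by lia.
have db : ~~ ((d == b) && (d == b.+1)) by lia.
have m1 : ~~ ((m == 1) && (1 < m)) by lia.
have m2 : (0 < m) = (m == 1) || (1 < m) by lia.
rewrite m2; move: {m2} (c == a) (c == a.+1) (d == b) (d == b.+1) (m == 1) (1 < m)
  (m <= _) ca db m1.
by do 7!case.
Qed.

Lemma card_weighted_delannoy_seq p q (s : seq (seq (step * nat))) :
  uniq s -> (forall W, (W \in s) = is_weighted_delannoy p q W) ->
  #|{: weighted_delannoy p q}| = size s.
Proof.
move=> us sE; rewrite cardE -(size_map val).
apply/perm_size/uniq_perm => //.
  by rewrite (map_inj_uniq val_inj) enum_uniq.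
move=> W; rewrite sE; apply/mapP/idP => [[X _ ->]|WP]; first exact: valP.
by exists (WeightedDelannoy WP); rewrite ?mem_enum.
Qed.

(** A path other than the empty one is a path to the starting point of its last
    step, followed by that step; [Ks] lists the possible last steps. *)
Lemma card_weighted_delannoy_last p q (Ks : seq (step * nat)) :
  0 < p + q -> uniq Ks ->
  (forall K, (K \in Ks) = is_weighted_step K && (K.1.2 == (p, q))) ->
  #|{: weighted_delannoy p q}|
    = \sum_(K <- Ks) #|{: weighted_delannoy K.1.1.1 K.1.1.2}|.
Proof.
move=> pq uK KE.
pose words (K : step * nat) :=
  [seq wd_word W | W <- enum {: weighted_delannoy K.1.1.1 K.1.1.2}].
rewrite (@card_weighted_delannoy_seq p q
           [seq rcons W K | K <- Ks, W <- words K]).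
- rewrite size_allpairs_dep sumnE big_map; apply: eq_bigr => K _.
  by rewrite size_map cardE.
- apply: allpairs_uniq_dep => //.
    by move=> K _; rewrite (map_inj_uniq val_inj) enum_uniq.
  by move=> [K W] [K' W'] _ _ /= /rcons_inj[-> ->].
move=> W; apply/allpairsPdep/idP => [[K [W' [KK /mapP[X _ ->] ->]]]|].
  rewrite weighted_delannoy_rcons andbA -KE KK; exact: (valP X).
case/lastP: W => [|W K].
  case/and3P=> _ /andP[_ /=] /eqP[p0 q0] _; move: pq; by rewrite -p0 -q0.
rewrite weighted_delannoy_rcons andbA -KE => /andP[KK WP].
exists K, W; split=> //; apply/mapP.
by exists (WeightedDelannoy WP); rewrite ?mem_enum.
Qed.

Lemma card_weighted_delannoy00 : #|{: weighted_delannoy 0 0}| = 1.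
Proof.
apply: (@card_weighted_delannoy_seq 0 0 [:: [::]]) => // W.
elim/last_ind: W => [|W [[s1 s2] m] _]; first by [].
rewrite weighted_delannoy_rcons inE -size_eq0 size_rcons.
apply/esym/negbTE/negP => /and3P[+ /eqP /= e2 _]; case: s1 => a b; rewrite e2.
by rewrite is_weighted_stepE /= !andbF.
Qed.

Lemma card_weighted_delannoyS0 p :
  #|{: weighted_delannoy p.+1 0}| = #|{: weighted_delannoy p 0}|.
Proof.
rewrite (@card_weighted_delannoy_last p.+1 0 [:: ((p, 0, (p.+1, 0)), 1)]) //.
  by rewrite big_seq1.
move=> [[[a b] [c d]] m]; rewrite inE is_weighted_stepE !xpair_eqE /=.
by apply/idP/idP; lia.
Qed.

Lemma card_weighted_delannoy0S q :
  #|{: weighted_delannoy 0 q.+1}| = #|{: weighted_delannoy 0 q}|.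
Proof.
rewrite (@card_weighted_delannoy_last 0 q.+1 [:: ((0, q, (0, q.+1)), 1)]) //.
  by rewrite big_seq1.
move=> [[[a b] [c d]] m]; rewrite inE is_weighted_stepE !xpair_eqE /=.
by apply/idP/idP; lia.
Qed.

Lemma card_weighted_delannoySS p q :
  #|{: weighted_delannoy p.+1 q.+1}| =
  #|{: weighted_delannoy p q.+1}| + #|{: weighted_delannoy p.+1 q}|
  + 2 * (p + q + 1) * #|{: weighted_delannoy p q}|.
Proof.
pose e := (p.+1, q.+1).
rewrite (@card_weighted_delannoy_last p.+1 q.+1
  [:: ((p, q.+1, e), 1), ((p.+1, q, e), 1)
    & [seq ((p, q, e), m) | m <- iota 2 (2 * (p + q + 1))]]) //.
- rewrite !big_cons big_map /= big_const_seq count_predT size_iota.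
  by rewrite iter_addn_0 addnA [_ * (2 * _)]mulnC.
- rewrite /= !inE negb_or !xpair_eqE /= map_inj_uniq ?iota_uniq; last first.
    by move=> ? ? [].
  by apply/and3P; split=> //; first (apply/andP; split; first lia);
    apply/mapP => -[m _ []]; lia.
move=> [[[a b] [c d]] m]; rewrite !inE is_weighted_stepE /=.
have -> : ((a, b, (c, d), m) \in
            [seq ((p, q, e), m) | m <- iota 2 (2 * (p + q + 1))])
          = ((a, b, (c, d)) == (p, q, e)) && (2 <= m <= 2 * (p + q + 1) + 1).
  apply/mapP/andP => [[m' + [-> -> -> -> ->]]|[/eqP-> m2]].
    by rewrite eqxx mem_iota; split=> //; lia.
  by exists m => //; rewrite mem_iota; lia.
rewrite /e !xpair_eqE /=.
apply/idP/idP; lia.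
Qed.

(** * Symmetric signed arc diagrams *)

Section ArcDiagrams.
Variables (T : finType) (rho : T -> T).
Hypotheses (rhoK : involutive rho) (rho_neq : forall z, rho z != z).

(** The function is meant to be an involution, whose 2-cycles are the arcs of the
    diagram; the set consists of the fixed points that bear the sign +. *)
Definition diagram := ({ffun T -> T} * {set T})%type.

Implicit Types (A : {set T}) (d : diagram) (x y z : T) (p : nat).

Definition closed_under A := forall z, (rho z \in A) = (z \in A).

Lemma closed_underU A (B : {set T}) :
  closed_under A -> closed_under B -> closed_under (A :|: B).
Proof. by move=> cA cB z; rewrite !in_setU cA cB. Qed.

Lemma closed_underD A (B : {set T}) :
  closed_under A -> closed_under B -> closed_under (A :\: B).
Proof. by move=> cA cB z; rewrite !in_setD cA cB. Qed.

Definition arc_ends (f : {ffun T -> T}) := [set z | f z != z].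

Definition arc_involution (f : {ffun T -> T}) : bool :=
  [&& [forall z, f (f z) == z], [forall z, f (rho z) == rho (f z)]
    & [forall z, f z != rho z]].

(** A diagram on [A] is made total by fixing the points outside [A].  The last
    condition encodes the sign balance: as each point of [A] bears a + or a - or
    ends an arc, if [A] has 2(p+q) points, then the number of +'s minus the
    number of -'s is 2p-2q exactly when twice the number of +'s plus the number
    of ends of arcs is 4p.  This form does not mention q. *)
Definition ssym_diagrams A p : {set diagram} :=
  [set d : diagram | [&& arc_involution d.1, arc_ends d.1 \subset A,
              d.2 \subset A :\: arc_ends d.1,
              [forall z, (rho z \in d.2) == (z \in d.2)]
            & 2 * #|d.2| + #|arc_ends d.1| == 4 * p]].

Lemma arc_involutionP (f : {ffun T -> T}) :
  reflect [/\ involutive f, {morph f : z / rho z} & forall z, f z != rho z]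
          (arc_involution f).
Proof.
apply: (iffP and3P) => -[H1 H2 H3].
  by split=> z; [exact/eqP/(forallP H1)|exact/eqP/(forallP H2)|exact/(forallP H3)].
by split; apply/forallP => z; rewrite ?H1 ?H2 ?H3.
Qed.

Lemma in_ssym_diagrams A p (f : {ffun T -> T}) (B : {set T}) :
  reflect [/\ arc_involution f, arc_ends f \subset A,
              B \subset A :\: arc_ends f, closed_under B
            & 2 * #|B| + #|arc_ends f| = 4 * p]
          ((f, B) \in ssym_diagrams A p).
Proof.
rewrite inE /=; apply: (iffP and5P) => -[H1 H2 H3 H4 H5]; split=> //.
- by move=> z; exact/eqP/(forallP H4).
- exact/eqP.
- by apply/forallP => z; rewrite H4.
- by rewrite H5.
Qed.

(** The +'s and the ends of arcs are disjoint in [A]; this makes the terms of the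
    recurrence with a negative q vanish. *)
Lemma card_ssym_diagrams_bound A p d : d \in ssym_diagrams A p -> 2 * p <= #|A|.
Proof.
case: d => f B /in_ssym_diagrams[_ fA BA _ E].
have := subset_leq_card BA; rewrite cardsD (setIidPr fA).
have := subset_leq_card fA; lia.
Qed.

Definition pair_at x := [set x; rho x].

Lemma pair_closed x : closed_under (pair_at x).
Proof.
by move=> z; rewrite !inE (inj_eq (inv_inj rhoK)) (can2_eq rhoK rhoK) orbC.
Qed.

Lemma card_pair_at x : #|pair_at x| = 2.
Proof. by rewrite cards2 eq_sym rho_neq. Qed.

(** Erasing a symmetric pair of -'s changes nothing but the ground set. *)
Lemma card_minus_fixed A p x : closed_under A -> x \in A ->
  #|[set d in ssym_diagrams A p | (d.1 x == x) && (x \notin d.2)]|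
    = #|ssym_diagrams (A :\: pair_at x) p|.
Proof.
move=> cA xA; apply: eq_card => -[f B]; rewrite inE /=.
apply/andP/in_ssym_diagrams.
  case=> /in_ssym_diagrams[fI fA BA cB E] /andP[/eqP fx xB]; split=> //.
    apply/subsetP => z zf; rewrite in_setD (subsetP fA _ zf) andbT !inE.
    case/arc_involutionP: fI => _ fr _.
    apply/norP; split; apply: contraTneq zf => ->; rewrite inE negbK ?fr fx //.
  apply/subsetP => z zB; have := subsetP BA _ zB; rewrite !inE => /andP[-> ->].
  rewrite !andbT; apply/norP; split; apply: contraTneq zB => ->; rewrite ?cB //.
case=> fI fA BA cB E; have nx (C : {set T}) : C \subset A :\: pair_at x -> x \notin C.
  by move=> sC; apply/negP => /(subsetP sC); rewrite !inE eqxx.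
split; first apply/in_ssym_diagrams; first split=> //.
- exact: subset_trans fA (subsetDl _ _).
- by apply: subset_trans BA _; apply: setSD; apply: subsetDl.
have := nx _ fA; rewrite inE negbK => -> /=; apply: nx.
by apply: subset_trans BA _; apply: subsetDl.
Qed.

(** The inverse of erasing the signs + of [x] and [rho x] is to add these two
    points to the set of +'s. *)
Lemma card_plus_fixed A p x : closed_under A -> x \in A ->
  #|[set d in ssym_diagrams A p.+1 | (d.1 x == x) && (x \in d.2)]|
    = #|ssym_diagrams (A :\: pair_at x) p|.
Proof.
move=> cA xA; pose g d : diagram := (d.1, d.2 :|: pair_at x).
have nx (A' B : {set T}) : B \subset A' :\: pair_at x -> B :&: pair_at x = set0.
  move=> sB; apply/eqP; rewrite setI_eq0; have := disjoints_subset B (pair_at x).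
  by move->; apply: subset_trans sB _; rewrite setDE subsetIr.
apply/esym; rewrite -(card_in_imset (f := g)); last first.
  move=> [f1 B1] [f2 B2] /in_ssym_diagrams[_ _ BA1 _ _].
  case/in_ssym_diagrams=> _ _ BA2 _ _ [/= <- E]; congr pair.
  have K (B : {set T}) f : B \subset (A :\: pair_at x) :\: arc_ends f ->
      B = (B :|: pair_at x) :\: pair_at x.
    move=> sB; rewrite setDUl setDv setU0; apply/esym/setDidPl.
    rewrite -setI_eq0; apply/eqP/(nx A).
    by apply: subset_trans sB _; apply: subsetDl.
  by rewrite (K _ _ BA1) (K _ _ BA2) E.
apply/esym/eq_card => -[f B]; rewrite inE /=; apply/andP/imsetP.
  case=> /in_ssym_diagrams[fI fA BA cB E] /andP[/eqP fx xB].
  have sxB : pair_at x \subset B by rewrite subUset !sub1set cB xB.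
  exists (f, B :\: pair_at x); last first.
    by rewrite /g /= -{1}(setID B (pair_at x)) (setIidPr sxB) setUC.
  apply/in_ssym_diagrams; split=> //.
  - apply/subsetP => z zf; rewrite in_setD (subsetP fA _ zf) andbT !inE.
    case/arc_involutionP: fI => _ fr _.
    apply/norP; split; apply: contraTneq zf => ->; rewrite inE negbK ?fr fx //.
  - by rewrite setDDl setUC -setDDl; apply: setSD.
  - exact: closed_underD cB (pair_closed x).
  have := cardsID (pair_at x) B; rewrite (setIidPr sxB) card_pair_at; lia.
case=> -[f' B'] /in_ssym_diagrams[fI fA BA cB E] [-> ->].
have xf : x \notin arc_ends f'.
  by apply/negP => /(subsetP fA); rewrite !inE eqxx.
have xf' : rho x \notin arc_ends f'.
  by apply/negP => /(subsetP fA); rewrite !inE eqxx orbT.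
split; first apply/in_ssym_diagrams; first split=> //.
- exact: subset_trans fA (subsetDl _ _).
- rewrite subUset; apply/andP; split.
    by apply: subset_trans BA _; apply: setSD; apply: subsetDl.
  by rewrite subUset !sub1set !in_setD xf xf' cA xA.
- exact: closed_underU cB (pair_closed x).
- rewrite cardsU (nx A) ?cards0 ?card_pair_at; first lia.
  by apply: subset_trans BA _; apply: subsetDl.
by move: xf; rewrite !inE negbK => ->; rewrite eqxx orbT.
Qed.

Definition quad x y := pair_at x :|: pair_at y.

(** The involution with exactly two arcs, x--y and rho x--rho y, when the four
    points are distinct.  Composing with it both inserts and erases these arcs. *)
Definition arc_swap x y z :=
  if z == x then y else if z == y then x
  else if z == rho x then rho y else if z == rho y then rho x else z.

Section Arc.
Variables x y : T.
Hypotheses (xy : y != x) (rxy : y != rho x).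

Let neqs : ((((x == y) = false) * ((x == rho x) = false) * ((x == rho y) = false))
  * (((y == x) = false) * ((y == rho x) = false) * ((y == rho y) = false))
  * (((rho x == x) = false) * ((rho x == y) = false) * ((rho x == rho y) = false))
  * (((rho y == x) = false) * ((rho y == y) = false) * ((rho y == rho x) = false)))%type.
Proof.
have e1 : (rho x == rho y) = false.
  by rewrite (inj_eq (inv_inj rhoK)) eq_sym (negbTE xy).
have e2 : (rho y == x) = false by rewrite (can2_eq rhoK rhoK) (negbTE rxy).
have [rx ry] := (negbTE (rho_neq x), negbTE (rho_neq y)).
do !split; rewrite ?rx ?ry ?e1 ?e2 ?(negbTE xy) ?(negbTE rxy) //;
  by rewrite eq_sym ?rx ?ry ?e1 ?e2 ?(negbTE xy) ?(negbTE rxy).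
Qed.

Local Notation X := (quad x y).
Local Notation t := (arc_swap x y).

Lemma quadE z : (z \in X) = [|| z == x, z == rho x, z == y | z == rho y].
Proof. by rewrite !inE !orbA. Qed.

Lemma quadP z : reflect [\/ z = x, z = rho x, z = y | z = rho y] (z \in X).
Proof. by rewrite quadE; apply: (iffP or4P) => -[/eqP|/eqP|/eqP|/eqP] ->;
  rewrite ?eqxx; constructor. Qed.

Lemma quad_closed : closed_under X.
Proof. exact: closed_underU (pair_closed x) (pair_closed y). Qed.

Lemma card_quad : #|X| = 4.
Proof.
rewrite cardsU !card_pair_at (_ : _ :&: _ = set0) ?cards0 //.
by apply/setP => z; rewrite !inE; case: eqP => [->|_]; last case: eqP => [->|_];
  rewrite ?neqs.
Qed.

Lemma arc_swapE : ((t x = y) * (t y = x) * (t (rho x) = rho y) * (t (rho y) = rho x))%type.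
Proof. by rewrite /arc_swap !eqxx !neqs. Qed.

Lemma arc_swap_out z : z \notin X -> t z = z.
Proof.
rewrite quadE /arc_swap.
by move=> /norP[/negbTE-> /norP[/negbTE-> /norP[/negbTE-> /negbTE->]]].
Qed.

Lemma arc_swap_in z : (t z \in X) = (z \in X).
Proof.
have [|zX] := boolP (z \in X); last by rewrite arc_swap_out ?(negbTE zX).
by case/quadP => ->; rewrite arc_swapE quadE !eqxx ?orbT.
Qed.

Lemma arc_swapK : involutive t.
Proof.
move=> z; have [|zX] := boolP (z \in X); last by rewrite !arc_swap_out.
by case/quadP => ->; rewrite !arc_swapE.
Qed.

Lemma arc_swap_morph : {morph t : z / rho z}.
Proof.
move=> z; have [|zX] := boolP (z \in X); last by rewrite !arc_swap_out ?quad_closed.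
by case/quadP => ->; rewrite ?rhoK !arc_swapE ?rhoK.
Qed.

Lemma arc_swap_moves z : z \in X -> (t z != z) && (t z != rho z).
Proof. by case/quadP => ->; rewrite arc_swapE ?rhoK !neqs. Qed.

(** As [f] fixes [X], the composite is [t] on [X] and [f] elsewhere, and both
    pieces are arc involutions of stable sets. *)
Lemma insert_arcP (f : {ffun T -> T}) : arc_involution f -> arc_ends f \subset ~: X ->
  let g := [ffun z => f (t z)] in
  [/\ arc_involution g, arc_ends g = arc_ends f :|: X & g x = y].
Proof.
move=> /arc_involutionP[fK fr fn] fX g.
have fin z : z \in X -> f z = z.
  by move=> zX; have := subsetP fX z; rewrite in_setC inE zX; case: eqP => // _ /(_ isT).
have gin z : z \in X -> g z = t z by move=> zX; rewrite ffunE fin ?arc_swap_in.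
have gout z : z \notin X -> g z = f z by move=> zX; rewrite ffunE arc_swap_out.
have fout z : z \notin X -> f z \notin X.
  by apply: contra => zX; rewrite -(fK z) fin.
split; last by rewrite gin ?arc_swapE // quadE eqxx.
  apply/arc_involutionP; split=> z; have [zX|zX] := boolP (z \in X).
  - by rewrite !gin ?arc_swapK ?arc_swap_in.
  - by rewrite !gout ?fout.
  - by rewrite !gin ?arc_swap_morph ?quad_closed.
  - by rewrite !gout ?fr ?quad_closed.
  - by rewrite gin //; case/andP: (arc_swap_moves zX).
  - by rewrite gout.
apply/setP => z; rewrite in_setU inE; have [zX|zX] := boolP (z \in X).
  by rewrite gin // orbT; case/andP: (arc_swap_moves zX) => ->.
by rewrite gout // orbF inE.
Qed.

(** By symmetry an arc x--y forces the arc rho x--rho y, so that [f] coincides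
    with [t] on [X] and the composite fixes [X]. *)
Lemma erase_arcP (f : {ffun T -> T}) : arc_involution f -> f x = y ->
  let g := [ffun z => f (t z)] in
  [/\ arc_involution g, arc_ends g = arc_ends f :\: X & X \subset arc_ends f].
Proof.
move=> /arc_involutionP[fK fr fn] fx g.
have fin z : z \in X -> f z = t z.
  by case/quadP=> ->; rewrite arc_swapE ?fr -?fx ?fK.
have gin z : z \in X -> g z = z.
  by move=> zX; rewrite ffunE fin ?arc_swap_in ?arc_swapK.
have gout z : z \notin X -> g z = f z by move=> zX; rewrite ffunE arc_swap_out.
have fout z : z \notin X -> f z \notin X.
  by apply: contra => zX; rewrite -(fK z) fin // arc_swap_in.
split; last first.
  by apply/subsetP => z zX; rewrite inE fin //; case/andP: (arc_swap_moves zX).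
  apply/setP => z; rewrite in_setD inE; have [zX|zX] := boolP (z \in X).
    by rewrite gin ?eqxx.
  by rewrite gout // inE.
apply/arc_involutionP; split=> z; have [zX|zX] := boolP (z \in X).
- by rewrite !gin.
- by rewrite !gout ?fout.
- by rewrite !gin ?quad_closed.
- by rewrite !gout ?fr ?quad_closed.
- by rewrite gin // eq_sym.
- by rewrite gout.
Qed.

(** Composition with [t] is its own inverse, hence injective; it removes four ends
    of arcs, that is, it lowers p by one. *)
Lemma card_arc A p : closed_under A -> x \in A -> y \in A ->
  #|[set d in ssym_diagrams A p.+1 | d.1 x == y]|
    = #|ssym_diagrams (A :\: X) p|.
Proof.
move=> cA xA yA; pose g d : diagram := ([ffun z => d.1 (t z)], d.2).
have gK : involutive g.
  by case=> f B; congr pair; apply/ffunP => z; rewrite !ffunE arc_swapK.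
have XA : X \subset A by rewrite !subUset !sub1set !cA xA yA.
rewrite -(card_imset _ (inv_inj gK)).
apply: eq_card => d; apply/imsetP/idP.
  case=> -[f B]; rewrite inE /= => /andP[] /in_ssym_diagrams[fI fA BA cB E] /eqP fx ->.
  have [gI gE Xf] := erase_arcP fI fx; apply/in_ssym_diagrams; split=> //=.
  - by rewrite gE setSD.
  - rewrite gE setDDl; apply/subsetP => z zB; have := subsetP BA _ zB.
    rewrite in_setD => /andP[zf zA].
    rewrite in_setD in_setU [z \in _ :\: X]in_setD negb_or zA andbT.
    by rewrite (contra (subsetP Xf z) zf) (negbTE zf).
  by rewrite gE cardsD (setIidPr Xf) card_quad; have := subset_leq_card Xf;
     rewrite card_quad; lia.
case: d => f B /in_ssym_diagrams[fI fA BA cB E].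
have fX : arc_ends f \subset ~: X.
  by apply: subset_trans fA _; rewrite setDE subsetIr.
have [gI gE gx] := insert_arcP fI fX.
exists (g (f, B)); last by rewrite gK.
rewrite inE /= gx eqxx andbT; apply/in_ssym_diagrams; split=> //.
- by rewrite gE subUset XA andbT; apply: subset_trans fA (subsetDl _ _).
- by rewrite gE setUC -setDDl.
rewrite gE cardsU (_ : _ :&: _ = set0) ?cards0 ?card_quad /=; first lia.
by apply/eqP; rewrite setI_eq0 disjoints_subset.
Qed.

End Arc.

(** When [p] is 0 all the points of [A] are -'s. *)
Lemma card_ssym_diagrams0 A : #|ssym_diagrams A 0| = 1.
Proof.
apply/eqP/cards1P; exists (finfun id, set0); apply/setP => -[f B].
rewrite [RHS]inE; apply/in_ssym_diagrams/eqP.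
  case=> _ _ _ _ E; have /eqP B0 : #|B| == 0 by lia.
  have /eqP/cards0_eq f0 : #|arc_ends f| == 0 by lia.
  rewrite (cards0_eq B0); congr pair.
  apply/ffunP => z; rewrite ffunE; apply/eqP.
  by have /setP/(_ z) := f0; rewrite !inE => /negbFE.
have i0 : arc_ends (finfun id) = set0.
  by apply/setP => z; rewrite !inE ffunE eqxx.
case=> -> ->; rewrite i0 cards0 !sub0set; split=> //.
  apply/arc_involutionP; split=> z; rewrite ?ffunE //; first by rewrite eq_sym.
by move=> z; rewrite !inE.
Qed.

(** The diagrams are sorted by the image of [x]: itself, with either sign, or
    one of the points of [A] other than [x] and [rho x]. *)
Lemma card_ssym_diagrams_rec A p x (m : nat) :
  closed_under A -> x \in A ->
  (forall y, y \in A :\: pair_at x ->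
     #|ssym_diagrams (A :\: quad x y) p| = m) ->
  #|ssym_diagrams A p.+1| =
    #|ssym_diagrams (A :\: pair_at x) p| + #|ssym_diagrams (A :\: pair_at x) p.+1|
    + #|A :\: pair_at x| * m.
Proof.
move=> cA xA Hm.
rewrite -sum1_card (partition_big (fun d : diagram => d.1 x) (mem A)) /=; last first.
  case=> f B /in_ssym_diagrams[/arc_involutionP[fK _ _] /subsetP fA _ _ _] /=.
  have [->//|nx] := eqVneq (f x) x; apply: fA.
  by rewrite inE fK eq_sym.
have term y : \sum_(d in ssym_diagrams A p.+1 | d.1 x == y) 1
              = #|[set d in ssym_diagrams A p.+1 | d.1 x == y]|.
  by rewrite sum1dep_card.
under eq_bigr do rewrite term.
rewrite (bigD1 x) //= (bigD1 (rho x)) /=; last by rewrite cA xA rho_neq.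
rewrite [X in _ + (X + _)](_ : _ = 0); last first.
  apply: eq_card0 => -[f B]; rewrite [LHS]inE; apply/negbTE/negP=> /= /andP[].
  case/in_ssym_diagrams=> /arc_involutionP[_ _ fn] _ _ _ _ /eqP fx.
  by have := fn x; rewrite fx eqxx.
rewrite add0n; congr (_ + _).
  rewrite -(card_plus_fixed p cA xA) -(card_minus_fixed p.+1 cA xA).
  rewrite -(cardsID [set d : diagram | x \in d.2]); congr (_ + _); apply: eq_card => d;
  by rewrite !inE -?andbA // andbC -!andbA.
rewrite -sum_nat_const; apply: eq_big => [y|y /andP[/andP[yA yx] yrx]].
  by rewrite !inE negb_or -andbA andbC.
by rewrite card_arc // Hm // !inE negb_or yA yx yrx.
Qed.

Lemma card_ssym_diagrams A p q :
  closed_under A -> #|A| = 2 * (p + q) ->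
  #|ssym_diagrams A p| = #|{: weighted_delannoy p q}|.
Proof.
have [n] := ubnP (p + q); elim: n A p q => // n IH A [|p] q.
  move=> _ _ _; rewrite card_ssym_diagrams0; elim: q => [|q IHq].
    by rewrite card_weighted_delannoy00.
  by rewrite card_weighted_delannoy0S.
move=> ltn cA cardA; have /card_gt0P[x xA] : 0 < #|A| by lia.
have c1 : closed_under (A :\: pair_at x).
  exact: closed_underD cA (pair_closed x).
have A1 : #|A :\: pair_at x| = 2 * (p + q).
  rewrite cardsD (setIidPr _) ?card_pair_at ?subUset ?sub1set ?cA ?xA //; lia.
have A2 y : y \in A :\: pair_at x ->
    closed_under (A :\: quad x y) /\ #|A :\: quad x y| + 4 = 2 * (p + q.+1).
  move=> y1; split; first exact: closed_underD cA (quad_closed x y).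
  have ry1 : rho y \in A :\: pair_at x by rewrite c1.
  have sub : pair_at y \subset A :\: pair_at x by rewrite subUset !sub1set y1.
  rewrite -[A :\: quad x y]setDDl cardsD (setIidPr sub) card_pair_at A1.
  have := subset_leq_card sub; rewrite card_pair_at A1; lia.
case: q ltn cardA A1 A2 => [|q] ltn cardA A1 A2.
  (* With q = 0, an arc or a - would leave too few points to reach the balance. *)
  rewrite (@card_ssym_diagrams_rec A p x 0) //; last first.
    move=> y /A2[_ c2]; apply/eqP; rewrite cards_eq0; apply/set0Pn => -[d].
    by move/card_ssym_diagrams_bound; lia.
  rewrite muln0 addn0 card_weighted_delannoyS0.
  rewrite (IH _ p 0) //.
  rewrite [X in _ + X](_ : _ = 0) ?addn0 //.
  apply/eqP; rewrite cards_eq0; apply/set0Pn => -[d].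
  by move/card_ssym_diagrams_bound; lia.
rewrite (@card_ssym_diagrams_rec A p x #|{: weighted_delannoy p q}|) //.
  rewrite card_weighted_delannoySS (IH _ p q.+1) ?(IH _ p.+1 q) ?A1 //; lia.
move=> y /A2[c2 cardA2]; apply: IH => //; lia.
Qed.

End ArcDiagrams.

(** * Clans as diagrams *)

Section ClanDiagrams.
Variable n : nat.
Implicit Types (c : n.-tuple symbol) (d : diagram 'I_n) (i j : 'I_n).

(** The word [c] depends on [d] only up to renaming of the numbers, which is
    what makes diagrams a model of clans rather than of preclans. *)
Definition represents c d : Prop :=
  [/\ involutive d.1, forall i, (tnth c i == Plus) = (i \in d.2)
    & forall i j, matching c i j = (d.1 i != i) && ((j == i) || (j == d.1 i))].

Lemma represents_num c d i :
  represents c d -> is_num (tnth c i) = (d.1 i != i).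
Proof. by case=> _ _ /(_ i i); rewrite /matching !eqxx !andbT. Qed.

Lemma represents_equiv c c' d :
  represents c d -> represents c' d -> clan_equiv c c'.
Proof.
move=> cd c'd; have [[_ P M] [_ P' M']] := (cd, c'd).
apply/clan_equivP; split=> [i|i|i j]; rewrite ?P ?P' ?M ?M' //.
have := represents_num i cd; rewrite -(represents_num i c'd).
have := P i; rewrite -P'; by case: (tnth c i) => [||k]; case: (tnth c' i) => [||l].
Qed.

Lemma equiv_represents c c' d :
  clan_equiv c c' -> represents c d -> represents c' d.
Proof.
case/clan_equivP => P _ M [dK dP dM].
by split=> // *; rewrite -?P -?M ?dP ?dM.
Qed.

Lemma represents_inj c d d' : represents c d -> represents c d' -> d = d'.
Proof.
move=> cd cd'; have [[_ P M] [_ P' M']] := (cd, cd').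
case: d d' => f B [f' B'] /= in cd cd' P M P' M' *; congr pair; last first.
  by apply/setP => i; rewrite -P -P'.
apply/ffunP => i; have := represents_num i cd; have := represents_num i cd'.
have := M i (f i); rewrite M' eqxx orbT /=.
have [->|_] /= := eqVneq (f i) i; last by case/andP=> _ /eqP.
by move=> _ -> /negbFE/eqP.
Qed.

(** The left end of an arc is a number that no other arc uses. *)
Definition word_of d : n.-tuple symbol :=
  [tuple if d.1 i == i then if i \in d.2 then Plus else Minus
         else Number (minn i (d.1 i)) | i < n].

Lemma word_ofP d :
  involutive d.1 -> (forall i, i \in d.2 -> d.1 i = i) ->
  represents (word_of d) d.
Proof.
case: d => f B /= fK Bf; split=> //= [i|i j].
  rewrite tnth_mktuple /=; have [_|fi] := eqVneq (f i) i; first by case: ifP.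
  by apply/esym/negbTE; apply: contraNN fi => /Bf ->.
rewrite /matching !tnth_mktuple /=.
have [_|fi] /= := eqVneq (f i) i; first by case: ifP.
have [fj|fj] := eqVneq (f j) j.
  rewrite (_ : (_ == _) = false); last by case: ifP.
  apply/esym/norP; split; apply: contraNneq fi => ji; first by rewrite -ji fj.
  by rewrite -{2}(fK i) -ji fj.
apply/eqP/orP => [[]|[]/eqP->//]; last by rewrite fK minnC.
case: (leqP i (f i)) => _; case: (leqP j (f j)) => _ /val_inj e.
- by left; rewrite e.
- by right; rewrite e fK.
- by right; rewrite e.
- by left; rewrite -(fK i) e fK.
Qed.

(** The default value [i] makes a sign its own partner. *)
Definition partner c i := odflt i [pick j | (j != i) && matching c i j].

Definition diagram_of c : diagram 'I_n :=
  ([ffun i => partner c i], [set i | tnth c i == Plus]).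

Lemma count_tuple (a : pred symbol) c : count a c = #|[set i | a (tnth c i)]|.
Proof.
rewrite cardsE -[X in count a X]map_tnth_enum count_map cardE -size_filter.
by rewrite enumT.
Qed.

(** A number that appears exactly twice has one other position, which makes the
    partner relation an involution. *)
Lemma diagram_ofP c :
  all (fun x => is_num x ==> (count_mem x c == 2)) c ->
  represents c (diagram_of c).
Proof.
move=> /allP two.
have mP i : is_num (tnth c i) ->
    partner c i != i /\ forall j, matching c i j = (j == i) || (j == partner c i).
  move=> ni; have := two _ (mem_tnth i c); rewrite ni /= count_tuple => /cards2P.
  case=> a [b [ab E]].
  have mE j : matching c i j = (j == a) || (j == b).
    by have /setP/(_ j) := E; rewrite /matching ni !inE eq_sym.
  rewrite /partner; case: pickP => [k /andP[ki mk]|no] /=.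
    split=> // j; have := mE i; rewrite {1}/matching ni eqxx /= => /esym.
    move: mk; rewrite !mE.
    case/orP => /eqP ka /orP[] /eqP ia; rewrite ka ia in ki *; rewrite ?eqxx // in ki *.
    by rewrite orbC.
  have := mE i; rewrite {1}/matching ni eqxx /= => /esym/orP[]/eqP ia.
    by have := no b; rewrite mE eqxx orbT ia eq_sym ab.
  by have := no a; rewrite mE eqxx ia ab.
have pP i : ~~ is_num (tnth c i) -> partner c i = i.
  move=> ni; rewrite /partner; case: pickP => //= j.
  by rewrite /matching (negbTE ni) andbF.
split=> /= [i|i|i j]; rewrite ?inE ?ffunE //; last first.
  have [ni|ni] := boolP (is_num (tnth c i)).
    by have [-> ->] := mP i ni.
  by rewrite pP // /matching (negbTE ni) eqxx.
have [ni|ni] := boolP (is_num (tnth c i)); last by rewrite !pP.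
have [pi mi] := mP i ni.
have /andP[_ /eqP e] : matching c i (partner c i) by rewrite mi eqxx orbT.
have [_ mj] := mP (partner c i) (etrans (congr1 _ (esym e)) ni).
have := mj i; rewrite /matching -e ni eqxx /= [i == partner c i]eq_sym (negbTE pi).
by move=> /esym/eqP.
Qed.

End ClanDiagrams.

(** The numbers of +'s, of -'s and of ends of arcs add up to 2(p+q), and this
    identifies the two forms of the sign balance. *)
Lemma represents_preclan p q (c : (2 * (p + q)).-tuple symbol) d :
  represents c d ->
  is_preclan c = (2 * #|d.2| + #|arc_ends d.1| == 4 * p).
Proof.
move=> cd; have [dK dP dM] := cd.
have two : all (fun x => is_num x ==> (count_mem x c == 2)) c.
  apply/allP => _ /tnthP[i ->]; apply/implyP => ni.
  rewrite count_tuple (_ : finset _ = [set i; d.1 i]).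
    by rewrite cards2 [i == _]eq_sym -(represents_num i cd) ni.
  apply/setP => j; rewrite !inE eq_sym.
  by have := dM i j; rewrite /matching -(represents_num i cd) ni.
rewrite /is_preclan two andbT.
have -> : count_mem Plus c = #|d.2|.
  by rewrite count_tuple; apply: eq_card => i; rewrite inE /= dP.
have := cardsC d.2; rewrite card_ord.
have -> : #|~: d.2| = count_mem Minus c + #|arc_ends d.1|.
  rewrite count_tuple -(cardsID (arc_ends d.1)) addnC; congr (_ + _); apply: eq_card => i;
  rewrite !inE -dP -(represents_num i cd) /=; by case: (tnth c i).
move=> E; apply/eqP/eqP; lia.
Qed.

(** There is no middle position, as the length is even. *)
Lemma rev_ord_neq m (i : 'I_(2 * m)) : rev_ord i != i.
Proof. by rewrite -val_eqE /=; have := ltn_ord i; lia. Qed.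

(** If the reversal preserves the +'s and the arcs, then it preserves the -'s,
    which are the remaining positions. *)
Lemma represents_ssymmetric p q (c : preclan p q) d :
  represents c d ->
  ssymmetric_preclan c = (d \in ssym_diagrams (@rev_ord _) setT p).
Proof.
move=> cd; have [dK dP dM] := cd.
have cnt := represents_preclan cd; rewrite (valP c) in cnt.
rewrite /ssymmetric_preclan /symmetric_preclan.
have symE : clan_equiv c [tuple of rev c] =
  [forall i, (rev_ord i \in d.2) == (i \in d.2)] &&
  [forall i, d.1 (rev_ord i) == rev_ord (d.1 i)].
  have mr i j : matching [tuple of rev c] i j = matching c (rev_ord i) (rev_ord j).
    by rewrite /matching !tnth_rev_tuple.
  apply/clan_equivP/andP => [[P _ M]|[/forallP P /forallP M]].
    split; apply/forallP => i; first by rewrite -!dP P tnth_rev_tuple rev_ordK.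
    have := M i (d.1 i); rewrite mr !dM eqxx orbT andbT (inj_eq rev_ord_inj).
    have [->|nfi] /= := eqVneq (d.1 i) i.
      by rewrite andbT => /esym/negbFE.
    by rewrite [_ == d.1 _]eq_sym => /esym/andP[].
  have numr i : is_num (tnth c (rev_ord i)) = is_num (tnth c i).
    rewrite !(represents_num _ cd) (eqP (M i)).
    by rewrite (inj_eq rev_ord_inj).
  split=> [i|i|i j].
  - by rewrite tnth_rev_tuple !dP (eqP (P i)).
  - have := numr i; have := P i; rewrite tnth_rev_tuple -!dP.
    by case: (tnth c i) => [||k]; case: (tnth c _) => [||l].
  by rewrite mr !dM (eqP (M i)) !(inj_eq rev_ord_inj).
have nE : [forall i, is_num (tnth c i) ==> (tnth c i != tnth c (rev_ord i))]
        = [forall i, d.1 i != rev_ord i].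
  apply: eq_forallb => i; have := dM i (rev_ord i).
  rewrite /matching (represents_num i cd).
  rewrite (negbTE (rev_ord_neq i)) /=.
  have [->|_] /= := eqVneq (d.1 i) i; first by rewrite eq_sym rev_ord_neq.
  by move=> ->; rewrite eq_sym.
rewrite symE nE {symE nE}.
case: d cd dK dP dM cnt => f B cd dK dP dM cnt /=.
apply/andP/in_ssym_diagrams.
  case=> /andP[/forallP P /forallP M] /forallP N; split.
  - by apply/arc_involutionP; split=> // i; apply/eqP.
  - exact: subsetT.
  - apply/subsetP => i; rewrite -(dP i) !inE andbT negbK.
    by have := represents_num i cd; case: (tnth c i) => //= /esym/negbFE.
  - by move=> i; apply/eqP.
  by apply/eqP; rewrite -cnt.
case=> /arc_involutionP[fK fr fn] _ _ cB _; split; last exact/forallP.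
by apply/andP; split; apply/forallP => i; apply/eqP.
Qed.

(** The diagram of a representative determines the clan, and each diagram arises
    from the class of the word that it spells. *)
Lemma card_ssymmetric_clans p q :
  num_ssymmetric_clans p q = #|ssym_diagrams (@rev_ord (2 * (p + q))) setT p|.
Proof.
have rep (c : preclan p q) : represents c (diagram_of c).
  by apply: diagram_ofP; case/andP: (valP c).
have eqv (c : preclan p q) : clan_equiv (repr (\pi_(clan p q) c)) c.
  by have /eqmodP := reprK (\pi_(clan p q) c).
pose F (x : clan p q) := diagram_of (repr x).
have Finj : injective F.
  move=> x y E; rewrite -(reprK x) -(reprK y); apply/eqmodP.
  by apply: represents_equiv (rep _) _; rewrite -/(F x) E; apply: rep.
rewrite /num_ssymmetric_clans -(card_imset _ Finj); apply: eq_card => d.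
apply/imsetP/idP => [[x sx ->]|dS].
  by rewrite -(represents_ssymmetric (rep _)).
have wd : represents (word_of d) d.
  apply: word_ofP; case: d dS => f B /in_ssym_diagrams[].
    by case/arc_involutionP.
  move=> _ _ BA _ _ i /(subsetP BA); rewrite !inE andbT negbK => /eqP //.
have pc : is_preclan (word_of d).
  rewrite (represents_preclan wd).
  by case: d dS {wd} => f B /in_ssym_diagrams[_ _ _ _ ->].
pose c := Preclan pc; exists (\pi_(clan p q) c).
  by rewrite inE ssymmetric_pi (@represents_ssymmetric _ _ c d wd).
apply: represents_inj (rep _); apply: equiv_represents wd.
by rewrite clan_equiv_sym; exact: eqv.
Qed.

Lemma eq_card_bijective (S T : finType) :
  #|S| = #|T| -> exists f : S -> T, bijective f.
Proof.
move=> E; exists (fun x => enum_val (cast_ord E (enum_rank x))).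
exists (fun y => enum_val (cast_ord (esym E) (enum_rank y))) => [x|y].
  by rewrite enum_valK cast_ordK enum_rankK.
by rewrite enum_valK cast_ordKV enum_rankK.
Qed.

Theorem theorem1p25 (p q : nat) :
  (exists f : weighted_delannoy p q -> ssymmetric_clan p q, bijective f)
  /\ num_ssymmetric_clans p q = \sum_(W : weighted_delannoy p q) 1.
Proof.
have E : num_ssymmetric_clans p q = #|{: weighted_delannoy p q}|.
  rewrite card_ssymmetric_clans; apply: card_ssym_diagrams.
  - exact: rev_ordK.
  - exact: rev_ord_neq.
  - by move=> z; rewrite !inE.
  by rewrite cardsT card_ord.
split; last by rewrite E sum1_card.
apply: (@eq_card_bijective (weighted_delannoy p q) {x : clan p q | ssymmetric x}).
by rewrite card_sig -E.
Qed.
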